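(* Let $n,\delta$ be positive integers. Any data structure that supports ${\textsf{rankA}}_1$ queries, or ${\textsf{dselectA}}_1$ queries, with additive error $\delta$ on an arbitrary bit-string of length $n$ requires at least $\lfloor n/(2\delta)\rfloor\lg\delta$ bits.
   Context: For a bit-string $B[1\dots n]$ and $b\in\{0,1\}$: ${\textsf{rank}}_b(i,B)$ is the number of $b$'s in $B[1\dots i]$, and ${\textsf{select}}_b(i,B)$ is the position of the $i$-th $b$ in $B$. ${\textsf{rankA}}_b(i,B,\delta)$ returns any value $r$ with ${\textsf{rank}}_b(i-\delta,B)<r\le{\textsf{rank}}_b(i,B)$, and if ${\textsf{rank}}_b(i-\delta,B)={\textsf{rank}}_b(i,B)$ it returns ${\textsf{rank}}_b(i,B)$. ${\textsf{dselectA}}_b(i,B,\delta)$ returns any position $p$ with ${\textsf{select}}_b(i,B)-\delta<p\le{\textsf{select}}_b(i,B)$. *)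

(* Defs.v *)
From mathcomp Require Import all_boot all_order all_algebra.
From mathcomp Require Import reals exp.

Set Implicit Arguments.
Unset Strict Implicit.
Unset Printing Implicit Defensive.

(* Positions in a bit-string are 1-based: B[j] is [nth _ B j.-1]. *)

Definition rank (b : bool) (i : nat) (B : seq bool) : nat :=
  count_mem b (take i B).

Definition positions (b : bool) (B : seq bool) : seq nat :=
  [seq j <- iota 1 (size B) | nth (~~ b) B j.-1 == b].

(* Meaningful for 1 <= i <= count_mem b B; it is 0 for larger i. *)
Definition select (b : bool) (i : nat) (B : seq bool) : nat :=
  nth 0 (positions b B) i.-1.

(* When i < delta the truncated i - delta is 0, and rank b 0 B = 0, which is
   the number of b's in the empty prefix. *)
Definition rankA_answer (b : bool) (i : nat) (B : seq bool) (delta r : nat) :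
    bool :=
  if rank b (i - delta) B == rank b i B then r == rank b i B
  else rank b (i - delta) B < r <= rank b i B.

(* select b i B < p + delta is select b i B - delta < p over the integers;
   0 < p because the answer is a position of B. *)
Definition dselectA_answer (b : bool) (i : nat) (B : seq bool) (delta p : nat) :
    bool :=
  [&& 0 < p, select b i B < p + delta & p <= select b i B].

(* A data structure occupying s bits for bit-strings of length n: queries only
   see the s stored bits. Both maps may depend on n (and on delta), and no
   computability or time bound is imposed on them. *)
Record data_structure (n s : nat) := DataStructure {
  encode : n.-tuple bool -> s.-tuple bool;
  query : s.-tuple bool -> nat -> nat
}.

Definition supports_rankA (b : bool) (delta n s : nat)
    (D : data_structure n s) : Prop :=
  forall (B : n.-tuple bool) (i : nat), 0 < i <= n ->
    rankA_answer b i B delta (query D (encode D B) i).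

Definition supports_dselectA (b : bool) (delta n s : nat)
    (D : data_structure n s) : Prop :=
  forall (B : n.-tuple bool) (i : nat), 0 < i <= count_mem b B ->
    dselectA_answer b i B delta (query D (encode D B) i).

Definition lg (R : realType) (x : R) : R := (ln x / ln 2)%R.

(* Main.v *)
(** Select queries tell two strings apart as soon as, for some i, the i-th b
    comes at least delta positions later in one of them: no position is a valid
    answer to the query i on both.  So do rank queries: just before the position
    p + delta, where p is the earlier of the two positions, a valid answer must
    be at least i on one string and less than i on the other.

    Cut a string of length n into blocks b^v (~b)^delta b^(delta - v) of length
    2 delta, where v <= delta is free.  Every block has delta occurrences of b,
    and whether the i-th of them is at position i or at position i + delta of
    the block depends on i <= v; hence strings given by different v's are told
    apart and must have different encodings.  The delta + 1 choices in each of
    n / (2 delta) blocks give slightly more than the claimed bound. *)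

Require Import Defs.
From mathcomp Require Import all_boot all_order all_algebra.
From mathcomp Require Import reals exp.
From mathcomp Require Import zify.

Set Implicit Arguments.
Unset Strict Implicit.
Unset Printing Implicit Defensive.

Import Order.TTheory GRing.Theory Num.Theory.

Section RankSelect.

Variable b : bool.
Implicit Types (A B Z : seq bool) (i j : nat).

Lemma positions_cat A Z :
  positions b (A ++ Z) = positions b A ++ map (addn (size A)) (positions b Z).
Proof.
rewrite /positions size_cat iotaD filter_cat; congr (_ ++ _).
  apply: eq_in_filter => j; rewrite mem_iota => j_range.
  by rewrite nth_cat; case: ltnP => //; lia.
rewrite addnC iotaDl filter_map; congr map.
apply: eq_in_filter => j; rewrite mem_iota => j_range /=.
rewrite nth_cat; case: ltnP; first by lia.
by move=> _; congr (nth _ _ _ == _); lia.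
Qed.

Lemma size_positions B : size (positions b B) = count_mem b B.
Proof.
elim: B => //= x B IHB; rewrite -cat1s positions_cat size_cat size_map IHB.
by case: b x {IHB} => [] [].
Qed.

Lemma select_cat A Z i : 0 < i <= count_mem b (A ++ Z) ->
  select b i (A ++ Z) =
    if i <= count_mem b A then select b i A
    else size A + select b (i - count_mem b A) Z.
Proof.
rewrite count_cat => i_range; rewrite /select positions_cat nth_cat.
rewrite size_positions.
have -> : (i.-1 < count_mem b A) = (i <= count_mem b A) by lia.
case: leqP => // A_i.
rewrite (nth_map 0) ?size_positions; last by lia.
by congr (_ + nth _ _ _); lia.
Qed.

Lemma select_nseq i k : 0 < i <= k -> select b i (nseq k b) = i.
Proof.
move=> i_range; rewrite /select /positions size_nseq.
have/all_filterP -> : all (fun j => nth (~~ b) (nseq k b) j.-1 == b) (iota 1 k).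
  by apply/allP => j; rewrite mem_iota nth_nseq => j_range; rewrite ifT //; lia.
by rewrite nth_iota; lia.
Qed.

Lemma select_range B i :
  0 < i <= count_mem b B -> 0 < select b i B <= size B.
Proof.
move=> i_range; have : select b i B \in positions b B.
  by apply: mem_nth; rewrite size_positions; lia.
by rewrite mem_filter mem_iota add1n ltnS => /andP[].
Qed.

Lemma leq_rank B i j : 0 < i <= count_mem b B ->
  (i <= rank b j B) = (select b i B <= j).
Proof.
move=> i_range; rewrite /rank.
have select_B := select_cat (A := take j B) (Z := drop j B) (i := i).
have count_B := count_cat (pred1 b) (take j B) (drop j B).
have size_B := size_cat (take j B) (drop j B).
rewrite cat_take_drop in select_B count_B size_B.
rewrite {}select_B //; case: leqP => [i_take | take_i].
  have/andP[_ /leq_trans -> //] : 0 < select b i (take j B) <= size (take j B).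
    by apply: select_range; case/andP: i_range => ->.
  by rewrite size_take_min geq_minl.
have/select_range : 0 < i - count_mem b (take j B) <= count_mem b (drop j B).
  by lia.
by have := size_take_min j B; lia.
Qed.

Lemma rankS_leq B j : rank b j.+1 B <= (rank b j B).+1.
Proof.
rewrite /rank -addn1 takeD count_cat -[leqRHS]addn1 leq_add2l.
by rewrite (leq_trans (count_size _ _)) // size_take_min geq_minl.
Qed.

Lemma rank_select_pred B i : 0 < i <= count_mem b B ->
  rank b (select b i B).-1 B = i.-1.
Proof.
move=> i_range; have/andP[select_gt0 _] := select_range i_range.
have := rankS_leq B (select b i B).-1; rewrite prednK // => rank_step.
have : i <= rank b (select b i B) B by rewrite leq_rank.
have : ~~ (i <= rank b (select b i B).-1 B) by rewrite leq_rank //; lia.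
by lia.
Qed.

Lemma rankA_answer_leq B i delta r :
  rankA_answer b i B delta r -> r <= rank b i B.
Proof. by rewrite /rankA_answer; case: ifP => [_ /eqP -> | _ /andP[]]. Qed.

Lemma rankA_answer_gt B i delta r :
  rank b (i - delta) B < rank b i B ->
  rankA_answer b i B delta r -> rank b (i - delta) B < r.
Proof. by rewrite /rankA_answer ltn_neqAle; case: eqP => // _ _ /andP[]. Qed.

End RankSelect.

Section SelectGap.

Variables (b : bool) (delta n s i : nat) (D : data_structure n s).
Variables B B' : n.-tuple bool.
Hypothesis i_B : 0 < i <= count_mem b B.
Hypothesis i_B' : 0 < i <= count_mem b B'.
Hypothesis select_gap : select b i B + delta <= select b i B'.

Lemma supports_rankA_encode_neq :
  0 < delta -> supports_rankA b delta D -> encode D B <> encode D B'.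
Proof.
move=> delta_gt0 rankA_D eqBB'.
have/andP[select_gt0 _] := select_range i_B.
have/andP[_ select_le_n] := select_range i_B'.
rewrite size_tuple in select_le_n.
pose j := (select b i B).-1 + delta.
have j_range : 0 < j <= n by rewrite /j; lia.
have answer_ge : i <= query D (encode D B) j.
  have rank_before : rank b (j - delta) B = i.-1.
    by rewrite addnK rank_select_pred.
  have := rankA_answer_gt _ (rankA_D B j j_range); rewrite rank_before.
  have : i <= rank b j B by rewrite leq_rank // /j; lia.
  by lia.
have answer_lt : query D (encode D B') j < i.
  apply: leq_ltn_trans (rankA_answer_leq (rankA_D B' j j_range)) _.
  by rewrite ltnNge leq_rank // /j; lia.
by move: answer_ge; rewrite eqBB' leqNgt answer_lt.
Qed.

Lemma supports_dselectA_encode_neq :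
  supports_dselectA b delta D -> encode D B <> encode D B'.
Proof.
move=> dselectA_D eqBB'.
have/and3P[_ _ answer_le] := dselectA_D B i i_B.
have/and3P[_ answer_gt _] := dselectA_D B' i i_B'.
by move: answer_le answer_gt; rewrite eqBB'; lia.
Qed.

End SelectGap.

Section Blocks.

Variables (b : bool) (delta : nat).
Implicit Types (v : 'I_delta.+1) (f : seq 'I_delta.+1) (Q : seq bool).

Definition block v : seq bool :=
  nseq v b ++ nseq delta (~~ b) ++ nseq (delta - v) b.

Lemma size_block v : size (block v) = 2 * delta.
Proof. by rewrite /block !size_cat !size_nseq; have := leq_ord v; lia. Qed.

Lemma count_block v : count_mem b (block v) = delta.
Proof.
rewrite /block !count_cat !count_nseq /= eqxx; have := leq_ord v.
by case: b => /=; lia.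
Qed.

Lemma select_block v i : 0 < i <= delta ->
  select b i (block v) = if i <= v then i else i + delta.
Proof.
move=> i_range; have v_le := leq_ord v.
have count_pad : count_mem b (nseq delta (~~ b)) = 0.
  by rewrite count_nseq; case: b.
have count_ones k : count_mem b (nseq k b) = k.
  by rewrite count_nseq /= eqxx mul1n.
rewrite select_cat; last by rewrite -/(block v) count_block.
rewrite count_ones size_nseq; case: leqP => [i_v | v_i].
  by rewrite select_nseq //; lia.
rewrite select_cat; last by rewrite count_cat count_pad count_ones; lia.
rewrite count_pad ifF; last by lia.
by rewrite size_nseq select_nseq; lia.
Qed.

Definition blocks f : seq bool := flatten (map block f).

Lemma size_blocks f : size (blocks f) = size f * (2 * delta).
Proof.
by elim: f => //= v f IHf; rewrite /blocks /= size_cat IHf size_block mulSn.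
Qed.

Lemma count_blocks f : count_mem b (blocks f) = size f * delta.
Proof.
by elim: f => //= v f IHf; rewrite /blocks /= count_cat IHf count_block mulSn.
Qed.

Lemma select_blocks f Q k i : k < size f -> 0 < i <= delta ->
  select b (k * delta + i) (blocks f ++ Q) =
    k * (2 * delta) + select b i (block (nth ord0 f k)).
Proof.
elim: f k => // v f IHf k k_lt i_range; rewrite /blocks /= -/(blocks f) -catA.
rewrite select_cat; last first.
  rewrite count_cat count_block (count_cat _ (blocks f)) count_blocks.
  by move: k_lt => /=; nia.
rewrite count_block size_block; case: k k_lt => [|k] k_lt.
  by rewrite mul0n !add0n ifT //; lia.
rewrite ifF; last by nia.
by rewrite [k.+1 * delta]mulSn -addnA addKn IHf // [k.+1 * _]mulSn addnA.
Qed.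

Lemma select_blocks_gap f g Q k i :
  k < size f -> k < size g -> nth ord0 g k < i <= nth ord0 f k ->
  select b (k * delta + i) (blocks f ++ Q) + delta =
    select b (k * delta + i) (blocks g ++ Q).
Proof.
move=> k_f k_g /andP[g_i i_f].
have i_range : 0 < i <= delta by have := leq_ord (nth ord0 f k); lia.
by rewrite !select_blocks // !select_block // i_f leqNgt g_i addnA.
Qed.

End Blocks.

Lemma leq_card_encode (T : finType) n s (D : data_structure n s)
    (B : T -> n.-tuple bool) : injective (encode D \o B) -> #|T| <= 2 ^ s.
Proof. by move/leq_card; rewrite card_tuple card_bool. Qed.

Lemma supports_expn_leq b delta n s (D : data_structure n s) : 0 < delta ->
  supports_rankA b delta D \/ supports_dselectA b delta D ->
  delta.+1 ^ (n %/ (2 * delta)) <= 2 ^ s.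
Proof.
move=> delta_gt0 supports_D; set m := n %/ (2 * delta).
pose Q := nseq (n %% (2 * delta)) b.
have size_string (f : m.-tuple 'I_delta.+1) : size (blocks b f ++ Q) == n.
  by rewrite size_cat size_blocks size_tuple size_nseq -divn_eq.
pose string f : n.-tuple bool := Tuple (size_string f).
have encode_neq (f g : m.-tuple 'I_delta.+1) (k : 'I_m) :
    tnth g k < tnth f k -> encode D (string f) <> encode D (string g).
  rewrite !(tnth_nth ord0) => g_f; set i := k * delta + (nth ord0 g k).+1.
  have i_range h : 0 < i <= count_mem b (string h).
    rewrite /= count_cat count_blocks size_tuple /i.
    by have := leq_ord (nth ord0 f k); have := ltn_ord k; nia.
  have gap : select b i (string f) + delta <= select b i (string g).
    by apply/eq_leq/select_blocks_gap; rewrite ?size_tuple // ltnSn.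
  case: supports_D.
  - exact: (supports_rankA_encode_neq (i_range f) (i_range g) gap).
  - exact: (supports_dselectA_encode_neq (i_range f) (i_range g) gap).
have encode_inj : injective (encode D \o string).
  move=> f g eq_fg; apply: eq_from_tnth => k.
  case: (ltngtP (tnth f k) (tnth g k)) => [f_g | g_f | /val_inj //].
  - by case: (encode_neq _ _ _ f_g).
  - by case: (encode_neq _ _ _ g_f).
by have := leq_card_encode encode_inj; rewrite card_tuple card_ord.
Qed.

Lemma mulr_lg_le (R : realType) (x : R) (m s : nat) :
  (0 < x -> x ^+ m <= 2 ^+ s -> m%:R * lg x <= s%:R)%R.
Proof.
move=> x_gt0 x_le.
have ln2_gt0 : (0 < ln 2 :> R)%R by rewrite ln_gt0 // ltr1n.
rewrite /lg mulrA ler_pdivrMr // !mulr_natl -!lnXn //.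
by rewrite ler_ln ?posrE ?exprn_gt0.
Qed.

Theorem theorem3 (R : realType) (n delta s : nat) (D : data_structure n s) :
  0 < n -> 0 < delta ->
  supports_rankA true delta D \/ supports_dselectA true delta D ->
  ((n %/ (2 * delta))%:R * lg (delta%:R : R) <= s%:R)%R.
Proof.
move=> _ delta_gt0 supports_D; apply: mulr_lg_le; first by rewrite ltr0n.
have := supports_expn_leq delta_gt0 supports_D.
rewrite -(ler_nat R) !natrX; apply: le_trans.
by rewrite lerXn2r ?nnegrE ?ler0n // ler_nat.
Qed.
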